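(* Let $\widehat{\boldsymbol p}\in\mathbb{R}^N$ and let $C = C^H\cap C^0\subseteq\mathbb{R}^N$, where $C^0$ is the feasible set of the families of linear constraints $(L_k,\omega_k)_{k\in[K]}$ and $C^H=\{\widehat{\boldsymbol v}\in\mathbb{R}^N : \|\widehat{\boldsymbol v}\|=\|\widehat{\boldsymbol p}\|\}$. Assume that: (a) the set of constraints $(L_k,\omega_k)_{k\in[K]}$ is $V$-determining; (b) the Euclidean projection of $\widehat{\boldsymbol p}$ onto $C^0$ satisfies $\mathcal{P}_{C^0}\widehat{\boldsymbol p}\neq \boldsymbol 0$; (c) $C^H=\mathbb{S}^{N-1}$, i.e. $\|\widehat{\boldsymbol p}\|=1$. Then the problem $$\boldsymbol d=\operatorname*{arg\,min}_{\widehat{\boldsymbol v}\in C} d(\widehat{\boldsymbol v},\widehat{\boldsymbol p})$$ (equivalently, the problem $\boldsymbol d=\operatorname*{arg\,min}_{\widehat{\boldsymbol v}\in C}\tfrac12\|\widehat{\boldsymbol v}-\widehat{\boldsymbol p}\|^2$) has a unique solution.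
   Context: Setting. $\Omega\subseteq\mathbb{R}^d$ is a domain and $H$ is a Hilbert space of real-valued functions on $\Omega$ with inner product $\langle\cdot,\cdot\rangle_H$. $V\subseteq H$ is an $N$-dimensional subspace with orthonormal basis $v_1,\dots,v_N$; it is assumed that $V$ has no common zeros on $\Omega$ (for every $x\in\Omega$ there is $v\in V$ with $v(x)\ne 0$). Elements $v=\sum_n\widehat v_n v_n\in V$ are identified with their coordinate vectors $\widehat{\boldsymbol v}\in\mathbb{R}^N$. Write $[K]=\{1,\dots,K\}$. $\|\cdot\|$ and $\langle\cdot,\cdot\rangle$ on $\mathbb{R}^N$ are Euclidean. Linear constraints. For each $k\in[K]$, $\omega_k$ is a subset of $\Omega$ (possibly uncountable), and for each $y\in\omega_k$, $L_k(\cdot,y)$ is a unit-norm element of the dual space $V^*$. Its Riesz representor in $V$ has coordinate vector $\widehat{\boldsymbol\ell}_k(y)=(L_k(v_1,y),\dots,L_k(v_N,y))^\top\in\mathbb{R}^N$, so $\|\widehat{\boldsymbol\ell}_k(y)\|=1$. Define the closed half-spaces $c_k(y)=\{\widehat{\boldsymbol v}\in\mathbb{R}^N : \langle\widehat{\boldsymbol v},\widehat{\boldsymbol\ell}_k(y)\rangle\le 0\}$, and $$C_k=\bigcap_{y\in\omega_k}c_k(y),\qquad C^0=\bigcap_{k\in[K]}C_k .$$ $V$-determining. The set of constraints $(L_k,\omega_k)_{k\in[K]}$ is $V$-determining if, whenever $v\in V$ satisfies $L_k(v,y)=0$ for all $y\in\omega_k$ and all $k\in[K]$, then $v=0$. Intrinsic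 distance. For $\boldsymbol u,\boldsymbol w\in\mathbb{S}^{N-1}$ (the unit sphere of $\mathbb{R}^N$), $d(\boldsymbol u,\boldsymbol w)=\arccos\langle\boldsymbol u,\boldsymbol w\rangle$. *)

(* Defs.v *)
From HB Require Import structures.
From mathcomp Require Import all_boot all_order all_algebra.
From mathcomp Require Import all_classical all_reals all_analysis.
Set Implicit Arguments.
Unset Strict Implicit.
Unset Printing Implicit Defensive.
Import Order.TTheory GRing.Theory Num.Theory numFieldNormedType.Exports.
Local Open Scope classical_set_scope.
Local Open Scope ring_scope.

Definition argmin (R : realType) (T : Type) (A : set T) (F : T -> R) : set T :=
  [set x | A x /\ forall y, A y -> F x <= F y].

(* The library norm on matrices is the sup norm, hence the Euclidean structure
   on R^N = 'cV[R]_N is introduced separately. *)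
Section Euclidean.
Context {R : realType} {N : nat}.
Implicit Types u w : 'cV[R]_N.

Definition edot u w : R := \sum_(n < N) u n 0 * w n 0.

Definition enorm u : R := Num.sqrt (edot u u).

Definition geodesic_dist u w : R := acos (edot u w).

(* When [A] is nonempty, closed and convex the minimizer exists and is unique;
   the default value [u] of [xget] is only returned if there is no minimizer. *)
Definition eproj (A : set 'cV[R]_N) u : 'cV[R]_N :=
  xget u (argmin A (fun w => enorm (w - u))).

End Euclidean.

Definition is_domain (R : realType) (d : nat) (Omega : set 'cV[R]_d) : Prop :=
  [/\ Omega !=set0, open Omega & connected Omega].

Section FunctionSpaces.
Context {R : realType} {X : Type}.
Implicit Types (H V : set (X -> R)) (ip : (X -> R) -> (X -> R) -> R).

Definition is_subspace V : Prop :=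
  V 0 /\ forall (a : R) f g, V f -> V g -> V (a *: f + g).

Definition ipnorm ip (f : X -> R) : R := Num.sqrt (ip f f).

(* The values of [ip] outside of [H] are irrelevant. *)
Record is_hilbert_function_space H ip : Prop := {
  hilbert_subspace : is_subspace H;
  hilbert_linear : forall (a : R) f g h, H f -> H g -> H h ->
    ip (a *: f + g) h = a * ip f h + ip g h;
  hilbert_sym : forall f g, H f -> H g -> ip f g = ip g f;
  hilbert_pos : forall f, H f -> f <> 0 -> 0 < ip f f;
  hilbert_complete : forall u : nat -> X -> R,
    (forall n, H (u n)) ->
    (forall e : R, 0 < e -> exists n0 : nat, forall m n : nat,
       (n0 <= m)%N -> (n0 <= n)%N -> ipnorm ip (u m - u n) < e) ->
    exists2 f, H f & (fun n => ipnorm ip (u n - f)) @ \oo --> (0 : R) }.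

Definition is_orthonormal_basis ip V (N : nat) (v : 'I_N -> X -> R) : Prop :=
  [/\ forall n, V (v n),
      forall m n, ip (v m) (v n) = (m == n)%:R
    & forall f, V f -> exists c : 'cV[R]_N, f = \sum_(n < N) c n 0 *: v n].

Definition no_common_zeros V : Prop :=
  forall x : X, exists2 f, V f & f x != 0.

(* The values of a functional outside of [V] are irrelevant. *)
Definition linear_on V (l : (X -> R) -> R) : Prop :=
  forall (a : R) f g, V f -> V g -> l (a *: f + g) = a * l f + l g.

Definition dual_norm ip V (l : (X -> R) -> R) : R :=
  sup [set `|l f| | f in [set f | V f /\ ipnorm ip f <= 1]].

End FunctionSpaces.

Section Constraints.
Context {R : realType} {X : Type} {K N : nat}.
Variables (v : 'I_N -> X -> R) (L : 'I_K -> (X -> R) -> X -> R).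
Variable omega : 'I_K -> set X.

Definition riesz_coords (k : 'I_K) (y : X) : 'cV[R]_N :=
  \col_(n < N) L k (v n) y.

Definition halfspace (k : 'I_K) (y : X) : set 'cV[R]_N :=
  [set c | edot c (riesz_coords k y) <= 0].

Definition constraint_cone (k : 'I_K) : set 'cV[R]_N :=
  \bigcap_(y in omega k) halfspace k y.

Definition feasible_set : set 'cV[R]_N :=
  \bigcap_(k in [set: 'I_K]) constraint_cone k.

Definition determining (V : set (X -> R)) : Prop :=
  forall f, V f -> (forall k y, omega k y -> L k f y = 0) -> f = 0.

End Constraints.

Definition norm_level_set (R : realType) (N : nat) (p : 'cV[R]_N) :
  set 'cV[R]_N := [set c | enorm c = enorm p].

(* Main.v *)
(* The feasible set F is a closed convex cone.  Let q <> 0 be the projection of p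
   onto F.  The variational inequality of the projection, applied along the cone,
   gives <w, p> <= <w, q> for all w in F and <q, q> <= <q, p>.  With u = q / |q|,
   every unit w in F thus satisfies <w, p> <= |q| <w, u> <= |q| <= <u, p>, and
   equality forces <w, u> = 1, i.e. w = u.  On the unit sphere both costs are
   strictly decreasing functions of <c, p>. *)
Require Import Defs.
From HB Require Import structures.
From mathcomp Require Import all_boot all_order all_algebra.
From mathcomp Require Import all_classical all_reals all_analysis.
From mathcomp Require Import ring lra.
Set Implicit Arguments.
Unset Strict Implicit.
Unset Printing Implicit Defensive.
Import Order.TTheory GRing.Theory Num.Theory numFieldNormedType.Exports.
Local Open Scope classical_set_scope.
Local Open Scope ring_scope.

(** * Euclidean inner product: algebra, unit vectors, continuity *)

Section EuclideanTheory.
Context {R : realType} {N : nat}.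
Implicit Types u w l : 'cV[R]_N.

Lemma edotC u w : edot u w = edot w u.
Proof. by apply: eq_bigr => n _; rewrite mulrC. Qed.

Lemma edotDl u w l : edot (u + w) l = edot u l + edot w l.
Proof. by rewrite -big_split; apply: eq_bigr => n _; rewrite mxE mulrDl. Qed.

Lemma edotZl a u l : edot (a *: u) l = a * edot u l.
Proof. by rewrite /edot mulr_sumr; apply: eq_bigr => n _; rewrite mxE mulrA. Qed.

Lemma edotDr u w l : edot l (u + w) = edot l u + edot l w.
Proof. by rewrite edotC edotDl !(edotC l). Qed.

Lemma edotZr a u l : edot l (a *: u) = a * edot l u.
Proof. by rewrite edotC edotZl edotC. Qed.

Lemma edotNl u l : edot (- u) l = - edot u l.
Proof. by rewrite -scaleN1r edotZl mulN1r. Qed.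

Lemma edotNr u l : edot l (- u) = - edot l u.
Proof. by rewrite edotC edotNl edotC. Qed.

Definition edotE := (edotDl, edotDr, edotNl, edotNr, edotZl, edotZr).

Lemma edot_ge0 u : 0 <= edot u u.
Proof. by apply: sumr_ge0 => n _; rewrite -expr2 sqr_ge0. Qed.

Lemma edot_eq0 u : edot u u = 0 -> u = 0.
Proof.
move=> /psumr_eq0P u0; apply/colP => n; rewrite mxE; apply/eqP.
by rewrite -(sqrf_eq0 (u n 0)) expr2 u0// => m _; rewrite -expr2 sqr_ge0.
Qed.

Lemma sqr_enorm u : enorm u ^+ 2 = edot u u.
Proof. by rewrite sqr_sqrtr ?edot_ge0. Qed.

Lemma ler_enorm u w : (enorm u <= enorm w) = (edot u u <= edot w w).
Proof. by rewrite ler_sqrt ?edot_ge0. Qed.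

Lemma enorm_eq1 u : enorm u = 1 <-> edot u u = 1.
Proof.
by split=> u1; [rewrite -sqr_enorm u1 expr1n | rewrite /enorm u1 sqrtr1].
Qed.

(** Polarization on the unit sphere. It yields Cauchy-Schwarz together with its equality case, and
    later links the quadratic cost to the inner product. *)
Lemma edot_unit u w : edot u u = 1 -> edot w w = 1 ->
  edot u w = 1 - 2^-1 * edot (u - w) (u - w).
Proof. by move=> u1 w1; rewrite !edotE u1 w1 (edotC w u); lra. Qed.

Lemma edot_unit_le1 u w : edot u u = 1 -> edot w w = 1 -> edot u w <= 1.
Proof. by move=> u1 w1; rewrite edot_unit//; have := edot_ge0 (u - w); lra. Qed.

Lemma edot_unit_eq u w :
  edot u u = 1 -> edot w w = 1 -> 1 <= edot u w -> u = w.
Proof.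
move=> u1 w1; rewrite edot_unit// => uw.
apply/subr0_eq/edot_eq0/eqP; rewrite eq_le edot_ge0 andbT; lra.
Qed.

Lemma edot_unit_itv u w : edot u u = 1 -> edot w w = 1 -> -1 <= edot u w <= 1.
Proof.
(* The lower bound is the upper bound for [- u] and [w]. *)
move=> u1 w1; rewrite edot_unit_le1// andbT -lerN2 opprK -edotNl.
by rewrite edot_unit_le1// !edotE opprK.
Qed.

Lemma continuous_edot_sub l : continuous (fun u => edot (u - l) (u - l)).
Proof.
apply: (continuous_big (@add_continuous R^o)) => n _.
have sub_cont : continuous (fun u => (u - l) n 0).
  rewrite [X in continuous X](_ : _ = fun u => u n 0 - l n 0).
    by move=> u; apply: continuousB; [exact: coord_continuous|exact: cst_continuous].
  by apply/funext => w; rewrite !mxE.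
by move=> u; apply: continuousM; exact: sub_cont.
Qed.

Lemma continuous_edotl l : continuous (fun u => edot u l).
Proof.
apply: (continuous_big (@add_continuous R^o)) => n _.
by move=> u; apply: continuousM; [exact: coord_continuous|exact: cst_continuous].
Qed.

Lemma closed_edot_le l (a : R) : closed [set u | edot u l <= a].
Proof.
apply: (@preimage_closed _ _ (fun u => edot u l) [set x | x <= a]).
  by move=> u _; exact: continuous_edotl.
exact: closed_le.
Qed.

Lemma closed_edot_sub_le l (a : R) : closed [set u | edot (u - l) (u - l) <= a].
Proof.
apply: (@preimage_closed _ _ (fun u => edot (u - l) (u - l)) [set x | x <= a]).
  by move=> u _; exact: continuous_edot_sub.
exact: closed_le.
Qed.

End EuclideanTheory.

(** * Compactness of balls and existence of projections *)

Lemma trmx_continuous (R : realType) m n :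
  continuous (trmx : 'M[R]_(m, n) -> 'M[R]_(n, m)).
Proof.
move=> M s /= /nbhs_ballP[e e0 es]; apply/nbhs_ballP; exists e => //= M' [_ MM'].
by apply: es; split=> // i j; rewrite !mxE.
Qed.

(** Since $|x| \le 1 + x^2$, a bound on [edot u u] bounds the sup norm without square roots. *)
Lemma coord_le_edotD1 (R : realType) N (u : 'cV[R]_N) n : `|u n 0| <= 1 + edot u u.
Proof.
have : u n 0 ^+ 2 <= edot u u.
  rewrite /edot (bigD1 n)//= -expr2 lerDl.
  by apply: sumr_ge0 => m _; rewrite -expr2 sqr_ge0.
rewrite -real_normK ?num_real//.
have := normr_ge0 (u n 0); nra.
Qed.

(* Heine-Borel is available for row vectors only, hence the transpositions. *)
Lemma compact_euclidean_ball (R : realType) N (l : 'cV[R]_N) (a : R) :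
  compact [set u | edot (u - l) (u - l) <= a].
Proof.
set B := [set _ | _].
have -> : B = trmx @` (trmx @^-1` B).
  apply/seteqP; split=> [u Bu|_ [r Br <-]//].
  by exists u^T; rewrite /= ?trmxK.
apply: continuous_compact.
  by apply: continuous_subspaceT; exact: trmx_continuous.
apply: bounded_closed_compact.
  exists (1 + a + `|l^T|); split=> [|M Mgt r Br] /=; first exact: num_real.
  apply: le_trans (ltW Mgt).
  rewrite -[r](subrK l^T) (le_trans (ler_normD _ _))// lerD2r.
  rewrite [leLHS]/Num.norm/= mx_normrE; apply: bigmax_le => [|[i j] _ /=].
    by rewrite addr_ge0// (le_trans (edot_ge0 _) Br).
  have := coord_le_edotD1 (r^T - l) j.
  rewrite !mxE ord1 => /le_trans; apply.
  by rewrite lerD2l.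
apply: preimage_closed; last exact: closed_edot_sub_le.
by move=> r _; exact: trmx_continuous.
Qed.

(** Minimize over the part of [F] in the closed ball around [p] through a point [z] of [F], which is
    compact; points of [F] outside this ball are farther from [p] than [z]. *)
Lemma eproj_argmin (R : realType) N (F : set 'cV[R]_N) (p : 'cV[R]_N) :
  closed F -> F !=set0 ->
  argmin F (fun w => enorm (w - p)) (eproj F p).
Proof.
move=> clF [z Fz]; rewrite /eproj; apply: xgetPex.
pose B := [set u : 'cV[R]_N | edot (u - p) (u - p) <= edot (z - p) (z - p)].
have [|||q] := @compact_EVT_min _ _ (fun w : 'cV[R]_N => edot (w - p) (w - p)) (B `&` F).
- by exists z; split=> //; rewrite /B/=.
- exact/compact_closedI/clF/compact_euclidean_ball.
- by apply: continuous_subspaceT; exact: continuous_edot_sub.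
rewrite inE => -[Bq Fq] qmin; exists q; split=> // w Fw.
rewrite ler_enorm; have [Bw|Bw] := leP (edot (w - p) (w - p)) (edot (z - p) (z - p)).
  by apply: qmin; rewrite inE.
exact: le_trans Bq (ltW Bw).
Qed.

(** * Projection onto a convex cone *)

Section ConvexCone.
Context {R : realType} {N : nat}.
Variables (F : set 'cV[R]_N) (p : 'cV[R]_N).
Hypothesis FZ : forall a u, 0 <= a -> F u -> F (a *: u).
Hypothesis FD : forall u w, F u -> F w -> F (u + w).

(** Otherwise a short step from [q] towards [w] stays in [F] and comes closer to [p]. *)
Lemma cone_argmin_variational q w :
  argmin F (fun w => enorm (w - p)) q -> F w -> edot (w - q) (p - q) <= 0.
Proof.
move=> [Fq qmin] Fw; rewrite leNgt; apply/negP => a_gt0.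
set a := edot _ _ in a_gt0; pose b := edot (w - q) (w - q).
have b_ge0 : 0 <= b := edot_ge0 _.
have ab_gt0 : 0 < b + a by lra.
(* Minimality will give $tb \ge 2a$, whereas this [t] satisfies $tb = a - ta < a$. Having [a] in the
   denominator keeps it positive when only $b \ge 0$ is known, and ensures $t \le 1$. *)
pose t := a / (b + a).
have t_gt0 : 0 < t by rewrite divr_gt0.
have t_le1 : t <= 1 by rewrite ler_pdivrMr//; lra.
have tab : t * (b + a) = a by rewrite divfK// gt_eqF.
have /qmin : F ((1 - t) *: q + t *: w).
  by apply: FD; apply: FZ => //; [lra | exact: ltW].
rewrite ler_enorm.
have -> : (1 - t) *: q + t *: w - p = t *: (w - q) - (p - q).
  by apply/colP => n; rewrite !mxE; ring.
have expand x y :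
    edot (t *: y - x) (t *: y - x) = t * (t * edot y y - 2 * edot y x) + edot x x.
  by rewrite !edotE (edotC x y); ring.
rewrite expand -(opprB p q) edotNl edotNr opprK lerDr pmulr_rge0// -/a -/b.
by have : 0 < t * a by [exact: mulr_gt0]; lra.
Qed.

(** Test the variational inequality at [q + w], so that its first factor is [w]. *)
Lemma cone_argmin_dual q w :
  argmin F (fun w => enorm (w - p)) q -> F w -> edot w p <= edot w q.
Proof.
move=> qmin Fw; have Fq := qmin.1.
have := cone_argmin_variational qmin (FD Fq Fw).
by rewrite addrC addKr !edotE subr_le0.
Qed.

(** The last clause serves twice: it excludes unit vectors of [F] better than [u], and it identifies
    those that are equally good. *)
Lemma cone_argmin_normalized q :
  argmin F (fun w => enorm (w - p)) q -> q <> 0 ->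
  let u := (enorm q)^-1 *: q in
  [/\ F u, edot u u = 1 & forall w, F w -> edot w w = 1 ->
     edot u p <= edot w p -> w = u].
Proof.
move=> qmin q0 /=; have Fq := qmin.1.
have n_gt0 : 0 < enorm q.
  rewrite sqrtr_gt0 lt_neqAle edot_ge0 andbT eq_sym.
  by apply/eqP => /edot_eq0.
have nE := sqr_enorm q.
move: (enorm q) n_gt0 nE => n n_gt0 nE.
have uu : edot (n^-1 *: q) (n^-1 *: q) = 1.
  by rewrite !edotE -nE expr2 mulKf ?mulVf ?gt_eqF.
split=> //; first by apply: FZ => //; rewrite invr_ge0 ltW.
(* With $n = |q|$, the chain is $n \le \langle u,p\rangle \le \langle w,p\rangle \le \langle
   w,q\rangle = n\langle w,u\rangle$. *)
move=> w Fw ww up_le; apply: edot_unit_eq => //.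
rewrite edotZr ler_pdivlMl// mulr1.
apply: le_trans (cone_argmin_dual qmin Fw); apply: le_trans up_le.
rewrite edotZl ler_pdivlMl// -expr2 nE.
(* Testing at the apex $0 = 0 \cdot q$ gives $\langle q,q\rangle \le \langle q,p\rangle$. *)
have := cone_argmin_variational qmin (FZ (lexx 0) Fq).
by rewrite scale0r sub0r edotNl oppr_le0 edotDr edotNr subr_ge0.
Qed.

End ConvexCone.

(** * The feasible set is a nonempty closed convex cone *)

Section FeasibleSet.
Context {R : realType} {X : Type} {K N : nat}.
Variables (v : 'I_N -> X -> R) (L : 'I_K -> (X -> R) -> X -> R).
Variable omega : 'I_K -> set X.

Lemma feasible_set_closed :
  closed (feasible_set v L omega).
Proof.
by do 2![apply: closed_bigI => ? _]; exact: closed_edot_le.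
Qed.

Lemma feasible_setZ (a : R) u :
  0 <= a -> feasible_set v L omega u -> feasible_set v L omega (a *: u).
Proof.
move=> a0 Fu k kT y yk; rewrite /halfspace/= edotZl.
by rewrite mulr_ge0_le0//; exact: Fu.
Qed.

Lemma feasible_setD u w :
  feasible_set v L omega u -> feasible_set v L omega w ->
  feasible_set v L omega (u + w).
Proof.
move=> Fu Fw k kT y yk; rewrite /halfspace/= edotDl -[leRHS]addr0.
by apply: lerD; [exact: Fu | exact: Fw].
Qed.

Lemma feasible_set_neq0 :
  feasible_set v L omega !=set0.
Proof.
by exists 0 => k _ y _; rewrite /halfspace/= -(scale0r 0) edotZl mul0r.
Qed.

End FeasibleSet.

(** * Comparison of costs and the final result *)

Lemma eq_argmin (R : realType) (T : Type) (A : set T) (F G : T -> R) :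
  (forall x y, A x -> A y -> (F x <= F y) = (G x <= G y)) ->
  argmin A F = argmin A G.
Proof.
move=> FG; apply/seteqP; split=> x [Ax xmin]; split=> // y Ay.
  by rewrite -FG// xmin.
by rewrite FG// xmin.
Qed.

(** Transfers the strict decrease of [cos] on $[0,\pi]$ through [acosK]. *)
Lemma ler_acos (R : realType) :
  {in `[(-1 : R), 1] &, {mono @acos R : x y /~ y <= x}}.
Proof.
have acos_itv (x : R) : x \in `[-1, 1] -> acos x \in `[0, pi].
  by rewrite !in_itv/= => x1; rewrite acos_ge0// acos_lepi.
move=> x y x1 y1; rewrite -{2}(acosK x1) -{2}(acosK y1).
by rewrite !leNgt ltr_cos// acos_itv.
Qed.

Unset Implicit Arguments.
Set Strict Implicit.

Theorem theorem3p1 (R : realType) (d N K : nat)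
  (Omega : set 'cV[R]_d) (hOmega : is_domain Omega)
  (H : set (Omega -> R)) (ip : (Omega -> R) -> (Omega -> R) -> R)
  (hH : is_hilbert_function_space H ip)
  (V : set (Omega -> R)) (hV : is_subspace V) (hVH : V `<=` H)
  (v : 'I_N -> Omega -> R) (hv : is_orthonormal_basis ip V v)
  (hV0 : no_common_zeros V)
  (omega : 'I_K -> set Omega) (L : 'I_K -> (Omega -> R) -> Omega -> R)
  (hLlin : forall k y, omega k y -> linear_on V (fun f => L k f y))
  (hLnorm : forall k y, omega k y -> dual_norm ip V (fun f => L k f y) = 1)
  (p : 'cV[R]_N)
  (hdet : determining L omega V)
  (hproj : eproj (feasible_set v L omega) p <> 0)
  (hp : enorm p = 1) :
  let C := norm_level_set p `&` feasible_set v L omega in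
  let geodesic_cost := fun c : 'cV[R]_N => geodesic_dist c p in
  let euclidean_cost := fun c : 'cV[R]_N => 2^-1 * enorm (c - p) ^+ 2 in
  (exists! c : 'cV[R]_N, argmin C geodesic_cost c) /\
  argmin C geodesic_cost = argmin C euclidean_cost.
Proof.
set F := feasible_set v L omega => /=.
have qmin := eproj_argmin p (@feasible_set_closed _ _ _ _ v L omega)
  (feasible_set_neq0 v L omega).
have [Fu uu u_unique] :=
  cone_argmin_normalized (@feasible_setZ _ _ _ _ v L omega)
  (@feasible_setD _ _ _ _ v L omega) qmin hproj.
set u := _ *: _ in Fu uu u_unique.
have pp : edot p p = 1 by apply/enorm_eq1.
have unit c : (norm_level_set p `&` F) c -> edot c c = 1.
  by move=> [cp _]; apply/enorm_eq1; rewrite cp.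
(* Both costs order the points of the constraint set as [- edot c p] does: the geodesic one by
   monotonicity of [acos], the quadratic one by [edot_unit]. *)
have geoE : argmin (norm_level_set p `&` F) (fun c => geodesic_dist c p) =
    argmin (norm_level_set p `&` F) (fun c => - edot c p).
  apply: eq_argmin => x y /unit xx /unit yy.
  by rewrite ler_acos ?in_itv/= ?edot_unit_itv// lerN2.
have eucE : argmin (norm_level_set p `&` F)
      (fun c => 2^-1 * enorm (c - p) ^+ 2) =
    argmin (norm_level_set p `&` F) (fun c => - edot c p).
  apply: eq_argmin => x y /unit xx /unit yy.
  rewrite !sqr_enorm lerN2 (edot_unit xx pp) (edot_unit yy pp).
  by rewrite lerD2l lerN2.
split; last by rewrite geoE eucE.
have Cu : (norm_level_set p `&` F) u.
  by split=> //; rewrite /norm_level_set/= hp; apply/enorm_eq1.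
rewrite geoE; exists u; split.
  (* A strictly better [w] would equal [u] by [u_unique], which is absurd. *)
  split=> // w Cw; rewrite lerN2 leNgt; apply/negP => uw.
  have wu : w = u by apply: u_unique (ltW uw); [exact: Cw.2 | exact: unit].
  by rewrite wu ltxx in uw.
move=> w [Cw wmin]; apply/esym/u_unique; [exact: Cw.2 | exact: unit |].
by rewrite -lerN2 wmin.
Qed.
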